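(* Let $q$ be a prime power, $r\ge 2$ an integer, and $u$ a positive integer with $u \mid \frac{q^r-1}{q-1}$. Let $\mathcal{X}_u=\{P_1,\dots,P_n\}$ be the set of rational points of the extended norm-trace curve over $\mathbb{F}_{q^r}$, and let $\mathcal{M}\subseteq\Delta\left(x^{(q-1)u+1},y^{q^{r-1}}\right)$ be a set of monomials closed under divisibility. Assume that the equation $x^2=u$ has a solution $\alpha$ in $\mathbb{F}_{q^r}$, and let $\boldsymbol{\lambda}=(\lambda_1,\dots,\lambda_n)$ with $\lambda_i:=\alpha^{-1}$ if the $x$-coordinate of $P_i$ is nonzero, and $\lambda_i:=1$ otherwise. If $\mathcal{M}\subseteq\mathcal{M}^\complement$, then $\boldsymbol{\lambda}\cdot\mathrm{ev}(\mathcal{M})$ is a self-orthogonal code. If $\mathcal{M}=\mathcal{M}^\complement$, then $\boldsymbol{\lambda}\cdot\mathrm{ev}(\mathcal{M})$ is a self-dual code.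
   Context: Let $Tr(y)=y^{q^{r-1}}+y^{q^{r-2}}+\cdots+y^q+y$. The set of rational points of the (affine) extended norm-trace curve is $\mathcal{X}_u=\{(\alpha,\beta)\in\mathbb{F}_{q^r}^2:\alpha^u=Tr(\beta)\}$. The evaluation map is $\mathrm{ev}:\mathbb{F}_{q^r}[x,y]\to\mathbb{F}_{q^r}^n$, $f\mapsto(f(P_1),\dots,f(P_n))$. A set $\mathcal{M}$ of monomials in $x,y$ is closed under divisibility if $M\in\mathcal{M}$ and $M'\mid M$ imply $M'\in\mathcal{M}$. For a set $\mathcal{M}$ of monomials, $\mathrm{ev}(\mathcal{M})$ denotes the image under $\mathrm{ev}$ of the $\mathbb{F}_{q^r}$-span of $\mathcal{M}$. $\Delta(x^i,y^j)$ denotes the set of monomials in $x,y$ that are multiples of neither $x^i$ nor $y^j$. The complement of $\mathcal{M}$ is $$\mathcal{M}^\complement:=\left\{\frac{x^{(q-1)u}y^{q^{r-1}-1}}{x^iy^j} : x^iy^j\in\Delta\left(x^{(q-1)u+1},y^{q^{r-1}}\right)\setminus\mathcal{M}\right\}.$$ For $\boldsymbol{\lambda}\in\mathbb{F}_{q^r}^n$ and a code $C\subseteq\mathbb{F}_{q^r}^n$, $\boldsymbol{\lambda}\cdot C=\{(\lambda_1c_1,\dots,\lambda_nc_n):(c_1,\dots,c_n)\in C\}$. With the dual taken with respect to the standard (Euclidean) bilinear form, a linear code $C$ is self-orthogonal if $C\subseteq C^\perp$ and self-dual if $C=C^\perp$. The integer $u$ is viewed as an element of $\mathbb{F}_q\subseteq\mathbb{F}_{q^r}$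 (it is nonzero there). *)

(* Defs.v *)
From HB Require Import structures.
From mathcomp Require Import all_boot all_order all_algebra.
From mathcomp Require Import boolp classical_sets.
From mathcomp Require Import mpoly.

Set Implicit Arguments.
Unset Strict Implicit.
Unset Printing Implicit Defensive.

Import GRing.Theory.
Local Open Scope classical_set_scope.
Local Open Scope ring_scope.

Definition Tr (F : finFieldType) (q r : nat) (y : F) : F :=
  \sum_(i < r) y ^+ (q ^ i).

Definition norm_trace_points (F : finFieldType) (q r u : nat) : set (F * F) :=
  [set P | P.1 ^+ u = Tr q r P.2].
Arguments norm_trace_points F q r u : clear implicits.

(* Monomials are exponent vectors in 'X_{1..2}: variable 0 is x, variable 1
   is y. Divisibility of monomials is (m' <= m)%MM, and the quotient of m by a
   divisor m' is (m - m')%MM. *)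
Definition xymon (i j : nat) : 'X_{1..2} :=
  [multinom of [:: i; j]].

Definition div_closed (M : set 'X_{1..2}) : Prop :=
  forall m m' : 'X_{1..2}, M m -> (m' <= m)%MM -> M m'.

(* Delta(x^a, y^b) *)
Definition footprint (a b : nat) : set 'X_{1..2} :=
  [set m | ~~ (xymon a 0 <= m)%MM /\ ~~ (xymon 0 b <= m)%MM].

(* Every m in the footprint divides the numerator, so the truncated
   subtraction of exponents is exact here. *)
Definition compl_mon (q r u : nat) (M : set 'X_{1..2}) : set 'X_{1..2} :=
  [set (xymon ((q - 1) * u) (q ^ (r - 1) - 1) - m)%MM
     | m in footprint ((q - 1) * u + 1) (q ^ (r - 1)) `\` M].

Definition mon_span (F : finFieldType) (M : set 'X_{1..2}) :
    set {mpoly F[2]} :=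
  [set f | exists (k : nat) (c : 'I_k -> F) (m : 'I_k -> 'X_{1..2}),
     (forall i, M (m i)) /\ f = \sum_(i < k) c i *: 'X_[m i]].
Arguments mon_span F M : clear implicits.

Definition ev (F : finFieldType) (n : nat) (P : 'I_n -> F * F)
    (f : {mpoly F[2]}) : 'rV[F]_n :=
  \row_i f.@[tnth [tuple (P i).1; (P i).2]].

Definition ev_code (F : finFieldType) (n : nat) (P : 'I_n -> F * F)
    (M : set 'X_{1..2}) : set 'rV[F]_n :=
  ev P @` mon_span F M.

Definition star (F : finFieldType) (n : nat) (l : 'rV[F]_n)
    (C : set 'rV[F]_n) : set 'rV[F]_n :=
  [set \row_i (l 0 i * c 0 i) | c in C].

Definition linear_code (F : finFieldType) (n : nat)
    (C : set 'rV[F]_n) : Prop :=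
  C 0 /\ forall (a : F) (v w : 'rV[F]_n), C v -> C w -> C (a *: v + w).

Definition dual_code (F : finFieldType) (n : nat)
    (C : set 'rV[F]_n) : set 'rV[F]_n :=
  [set v | forall c, C c -> \sum_i v 0 i * c 0 i = 0].

Definition self_orthogonal (F : finFieldType) (n : nat)
    (C : set 'rV[F]_n) : Prop :=
  linear_code C /\ C `<=` dual_code C.

Definition self_dual (F : finFieldType) (n : nat)
    (C : set 'rV[F]_n) : Prop :=
  linear_code C /\ C = dual_code C.

(* Main.v *)
(* Write s = (q-1)u and Q = q^(r-1).  The weight lambda_i^2 is the value at x of
   D = (X^(q^r) - X) / (X^(s+1) - X), and D vanishes at every other x in F; likewise
   1 - (Tr y - c)^(q-1) is the indicator of a fibre Tr y = c.  So the sum of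
   lambda^2 x^a y^b over the curve is a power sum over F x F, and power sums of
   degree below q^r - 1 vanish.  This gives 0 when a < s or b < Q - 1 (with
   b <= 2(Q - 1)) and -1 at (s, Q - 1).  If M is contained in its complement and
   m, m' are in M, then m m' is not divisible by x^s y^(Q-1), which yields
   self-orthogonality.  For the converse inclusion, every word is the evaluation
   of some f supported in the footprint; if v is in the dual, take a monomial
   of f of maximal degree outside M and pair v with its complementary monomial,
   which lies in M: only that term survives, so its coefficient is 0. *)
Require Import Defs.
From HB Require Import structures.
From mathcomp Require Import all_boot all_order all_algebra finfield.
From mathcomp Require Import boolp classical_sets.
From mathcomp Require Import mpoly zify ring.

Set Implicit Arguments.
Unset Strict Implicit.
Unset Printing Implicit Defensive.

Import GRing.Theory.
Local Open Scope classical_set_scope.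
Local Open Scope ring_scope.

(** * Power sums and interpolation over a finite field *)

Lemma card_finField_gt1 (F : finFieldType) : (1 < #|F|)%N.
Proof. exact: finNzRing_gt1. Qed.

(** Translation by 1 permutes [F] but adds [#|F|] to the sum of its elements. *)
Lemma natr_card_finField (F : finFieldType) : #|F|%:R = 0 :> F.
Proof.
apply: (addrI (\sum_(x : F) x)); rewrite addr0 [RHS](reindex_inj (addIr 1)) /=.
by rewrite big_split sumr_const.
Qed.

Lemma expf_card_pred (F : finFieldType) (x : F) : x != 0 -> x ^+ #|F|.-1 = 1.
Proof.
move=> x0; apply: (mulfI x0); rewrite mulr1 -exprS prednK ?expf_card //.
exact: ltnW (card_finField_gt1 F).
Qed.

(** Since ['X^d - 1] has at most [d] roots, some nonzero [z] has [z ^+ d != 1]; scaling the variable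
    by [z] multiplies the sum by [z ^+ d]. For [d = 0] the sum is [#|F|], with [0 ^+ 0 = 1]. *)
Lemma sum_expr_lt (F : finFieldType) d :
  (d < #|F|.-1)%N -> \sum_(x : F) x ^+ d = 0.
Proof.
case: (posnP d) => [-> _|d_gt0 d_lt].
  by under eq_bigr do rewrite expr0; rewrite sumr_const natr_card_finField.
have [z z_neq0 zd] : exists2 z : F, z != 0 & z ^+ d != 1.
  apply/exists_inP; apply: contraLR d_lt.
  rewrite negb_exists_in -leqNgt => /forall_inP Hd.
  have p_neq0 : 'X^d - 1 != 0 :> {poly F}.
    by rewrite -size_poly_gt0 size_XnsubC.
  have /(max_poly_roots p_neq0) : all (root ('X^d - 1)) (rem 0 (enum F)).
    apply/allP => x; rewrite mem_rem_uniq ?enum_uniq // inE => /andP[x0 _].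
    by rewrite rootE !hornerE subr_eq0 -[_ == _]negbK Hd.
  rewrite rem_uniq ?enum_uniq // => /(_ isT).
  by rewrite size_XnsubC // size_rem ?mem_enum // -cardE ltnS.
apply: (mulfI (_ : z ^+ d - 1 != 0)); first by rewrite subr_eq0.
rewrite mulr0 mulrBl mul1r mulr_sumr; apply/eqP; rewrite subr_eq0; apply/eqP.
rewrite [RHS](reindex_inj (mulfI z_neq0)).
by apply: eq_bigr => x _; rewrite exprMn.
Qed.

Lemma sum_expr_card_pred (F : finFieldType) : \sum_(x : F) x ^+ #|F|.-1 = -1.
Proof.
have card_gt1 := card_finField_gt1 F.
have card_pred_gt0 : (0 < #|F|.-1)%N by rewrite -subn1 subn_gt0.
rewrite (bigD1 0) //= expr0n gtn_eqF ?card_pred_gt0 // add0r.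
rewrite (eq_bigr (fun=> 1)) => [|x x0]; last exact: expf_card_pred.
rewrite sumr_const (eq_card (_ : _ =i predC1 0)) // cardC1.
by rewrite -subn1 natrB ?natr_card_finField ?sub0r // ltnW.
Qed.

(** Expanding in coefficients, all power sums vanish except the one of exponent [#|F|.-1], which is
    -1. *)
Lemma sum_horner (F : finFieldType) (g : {poly F}) :
  (size g <= #|F|)%N -> \sum_(x : F) g.[x] = - g`_#|F|.-1.
Proof.
have card_gt1 := card_finField_gt1 F; move=> size_g.
under eq_bigr do rewrite (horner_coef_wide _ size_g).
rewrite exchange_big /=; under eq_bigr do rewrite -mulr_sumr.
have card_gt0 : (#|F|.-1 < #|F|)%N by rewrite prednK // ltnW.
rewrite (bigD1 (Ordinal card_gt0)) //= sum_expr_card_pred mulrN1 big1 ?addr0 //.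
move=> i /eqP/val_eqP /= i_neq; rewrite sum_expr_lt ?mulr0 //=.
by have := ltn_ord i; lia.
Qed.

Lemma sum_horner0 (F : finFieldType) (g : {poly F}) :
  (size g < #|F|)%N -> \sum_(x : F) g.[x] = 0.
Proof.
move=> size_g; rewrite sum_horner 1?ltnW // nth_default ?oppr0 //.
by rewrite -ltnS prednK // (leq_ltn_trans _ size_g).
Qed.

(** Lagrange interpolation: [L] is the normalized product of ['X - y%:P] over the other roots [y] of
    [f] in [F]. *)
Lemma exists_root_indicator (F : finFieldType) (f : {poly F}) (x0 : F) :
  f != 0 -> root f x0 ->
  exists2 L : {poly F}, (size L < size f)%N &
    forall x, root f x -> L.[x] = (x == x0)%:R.
Proof.
move=> f0 fx0; pose rs := enum [pred x | root f x & x != x0].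
pose g := \prod_(y <- rs) ('X - y%:P).
have size_rs : (size (x0 :: rs) < size f)%N.
  apply: max_poly_roots => //=; last by rewrite enum_uniq mem_enum inE /= eqxx andbF.
  by rewrite fx0 /=; apply/allP => x; rewrite mem_enum inE => /andP[].
have gx0 : g.[x0] != 0.
  by rewrite -[_ == _]/(root g x0) root_prod_XsubC mem_enum inE /= eqxx andbF.
exists (g.[x0]^-1 *: g).
  by rewrite (leq_ltn_trans (size_scale_leq _ _)) // size_prod_XsubC.
move=> x fx; rewrite hornerZ; have [->|neq] := eqVneq x x0; first by rewrite mulVf.
have /rootP -> : root g x by rewrite root_prod_XsubC mem_enum inE /= fx.
by rewrite mulr0.
Qed.

(** * Monomials in two variables as pairs of exponents *)

Lemma xymon0 i j : xymon i j ord0 = i.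
Proof. by rewrite /xymon multinomE (tnth_nth 0%N). Qed.

Lemma xymon1 i j : xymon i j ord_max = j.
Proof. by rewrite /xymon multinomE (tnth_nth 0%N). Qed.

Lemma xymonK (m : 'X_{1..2}) : xymon (m ord0) (m ord_max) = m.
Proof.
apply/mnmP => i; have [->|->] : i = ord0 \/ i = ord_max.
- by case: i => [[|[|//]] ?]; [left | right]; apply: val_inj.
- exact: xymon0.
- exact: xymon1.
Qed.

Lemma xymon_leP (m m' : 'X_{1..2}) :
  (m <= m')%MM = (m ord0 <= m' ord0)%N && (m ord_max <= m' ord_max)%N.
Proof.
apply/mnm_lepP/andP => [le_m | [le0 le1] i]; first by split; apply: le_m.
have [->|->] // : i = ord0 \/ i = ord_max.
by case: i => [[|[|//]] ?]; [left | right]; apply: val_inj.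
Qed.

Lemma footprintP a b (m : 'X_{1..2}) :
  footprint a b m <-> (m ord0 < a)%N /\ (m ord_max < b)%N.
Proof.
rewrite /footprint /= !xymon_leP !xymon0 !xymon1 leq0n andbT /= -!ltnNge.
by [].
Qed.

Lemma ltn_add_subn m d t : (m < d)%N -> (d <= t)%N -> (m + (t - d) < t)%N.
Proof. lia. Qed.

(** * Spans of monomials and their evaluation codes *)

Section Codes.

Variables (F : finFieldType) (M : set 'X_{1..2}).

Lemma mon_span0 : mon_span F M 0.
Proof.
exists 0%N, (fun=> 0), (fun=> xymon 0 0); split; first by case.
by rewrite big_ord0.
Qed.

Lemma mon_spanX m : M m -> mon_span F M 'X_[m].
Proof.
move=> Mm; exists 1%N, (fun=> 1), (fun=> m); split=> //.
by rewrite big_ord1 scale1r.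
Qed.

Lemma mon_span_linear a f g :
  mon_span F M f -> mon_span F M g -> mon_span F M (a *: f + g).
Proof.
move=> [k1 [c1 [m1 [Mm1 ->]]]] [k2 [c2 [m2 [Mm2 ->]]]].
exists (k1 + k2)%N.
exists (fun i => match split i with inl j => a * c1 j | inr j => c2 j end).
exists (fun i => match split i with inl j => m1 j | inr j => m2 j end).
split=> [i|]; first by case: split.
rewrite big_split_ord scaler_sumr; congr (_ + _); apply: eq_bigr => i _.
  by rewrite (unsplitK (inl _ i)) scalerA.
by rewrite (unsplitK (inr _ i)).
Qed.

Variables (n : nat) (P : 'I_n -> F * F).

Lemma ev0 : ev P 0 = 0.
Proof. by apply/rowP => j; rewrite !mxE meval0. Qed.

Lemma ev_linear a f g : ev P (a *: f + g) = a *: ev P f + ev P g.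
Proof. by apply/rowP => j; rewrite !mxE mevalD mevalZ. Qed.

Lemma evX m j : ev P 'X_[m] 0 j = (P j).1 ^+ m ord0 * (P j).2 ^+ m ord_max.
Proof.
rewrite mxE mevalX big_ord_recl big_ord1; congr (_ ^+ _ * _ ^+ _).
by congr (m _); apply: val_inj.
Qed.

Lemma linear_star_ev_code (l : 'rV[F]_n) : linear_code (star l (ev_code P M)).
Proof.
split.
  exists 0; last by apply/rowP => j; rewrite !mxE mulr0.
  by exists 0; [exact: mon_span0 | exact: ev0].
move=> a _ _ [_ [f Mf <-] <-] [_ [g Mg <-] <-].
exists (ev P (a *: f + g)); first by exists (a *: f + g) => //; apply: mon_span_linear.
by apply/rowP => j; rewrite ev_linear !mxE mulrDr mulrCA.
Qed.

(** Reduces orthogonality to monomials by linearity. As [v] is arbitrary, the lemma can be applied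
    to each argument of the pairing in turn. *)
Lemma sum_ev_eq0 (v : 'I_n -> F) f :
  (forall m, M m -> \sum_j v j * ev P 'X_[m] 0 j = 0) ->
  mon_span F M f -> \sum_j v j * ev P f 0 j = 0.
Proof.
move=> v_ortho [k [c [m [Mm ->]]]].
have ev_sum j : ev P (\sum_(i < k) c i *: 'X_[m i]) 0 j =
    \sum_(i < k) c i * ev P 'X_[m i] 0 j.
  rewrite mxE raddf_sum /=.
  by apply: eq_bigr => i _; rewrite mevalZ mxE.
under eq_bigr do rewrite ev_sum mulr_sumr.
rewrite exchange_big big1 // => i _; rewrite /=.
by under eq_bigr do rewrite mulrCA; rewrite -mulr_sumr v_ortho ?mulr0.
Qed.

End Codes.

(** * Power sums over the fibres of the trace *)

Section Trace.

Variables (F : finFieldType) (q r : nat).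
Hypotheses (q_gt1 : (1 < q)%N) (r_gt0 : (0 < r)%N).
Hypotheses (card_F : #|F| = (q ^ r)%N) (q_char : [pchar F].-nat q).

Local Notation T := (\sum_(i < r) 'X^(q ^ i) : {poly F}).
Local Notation Q := (q ^ (r - 1))%N.

Let card_FE : #|F| = (q * Q)%N.
Proof. by rewrite card_F -expnS subn1 prednK. Qed.

Let Q_gt0 : (0 < Q)%N.
Proof. by rewrite expn_gt0 (ltnW q_gt1). Qed.

Let leq_Q k : (k < Q)%N -> (k <= Q - 1)%N.
Proof. by move: Q_gt0; lia. Qed.

Lemma horner_trace_poly y : T.[y] = Tr q r y.
Proof. by rewrite horner_sum; apply: eq_bigr => i _; rewrite hornerXn. Qed.

Lemma size_trace_polyB_polyC c : size (T - c%:P) = Q.+1 /\ T - c%:P \is monic.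
Proof.
move: (r_gt0) (q_gt1); case: (r) => // r' _ q1; rewrite big_ord_recr subn1 /=.
set S := \sum_(i < _) _; rewrite -addrA addrC -addrA.
have lt_size : (size (- c%:P + S)%R < size ('X^(q ^ r') : {poly F}))%N.
  rewrite size_polyXn ltnS (leq_trans (size_polyD _ _)) // geq_max.
  rewrite size_polyN size_polyC (leq_trans (leq_b1 _)) ?expn_gt0 ?(ltnW q1) //=.
  rewrite (leq_trans (size_sum _ _ _)) //; apply/bigmax_leqP => i _.
  by rewrite size_polyXn ltn_exp2l.
by rewrite size_polyDl // size_polyXn monicE lead_coefDl // lead_coefXn.
Qed.

Lemma exprD_q (x y : F) : (x + y) ^+ q = x ^+ q + y ^+ q.
Proof. exact: exprDn_pchar. Qed.

(** The [q]-th power map permutes the summands cyclically, because [y ^+ (q ^ r) = y]. *)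
Lemma Tr_expr_q (y : F) : Tr q r y ^+ q = Tr q r y.
Proof.
rewrite /Tr (big_morph (fun x : F => x ^+ q) exprD_q (id1 := 0)); last first.
  by rewrite expr0n -leqn0 leqNgt (ltnW q_gt1).
under eq_bigr do rewrite -exprM -expnSr.
move: (r_gt0) (card_F); case: (r) => // r' _ card_F'.
rewrite big_ord_recr big_ord_recl /= -card_F' expf_card expn0 expr1 addrC.
by congr (_ + _).
Qed.

Lemma exprB_q (x y : F) : (x - y) ^+ q = x ^+ q - y ^+ q.
Proof.
by apply: (addIr (y ^+ q)); rewrite -exprD_q !subrK.
Qed.

Definition fiber_sum b (c : F) : F := \sum_(y | Tr q r y == c) y ^+ b.

(** Both [Tr q r y] and [c] are fixed by [q]-th powers, so their difference has [(q - 1)]-st power 0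
    or 1. *)
Lemma fiber_sumE b c : c ^+ q = c ->
  fiber_sum b c = \sum_y ('X^b * (1 - (T - c%:P) ^+ (q - 1))).[y].
Proof.
move=> c_q; rewrite /fiber_sum big_mkcond; apply: eq_bigr => y _.
rewrite !hornerE horner_trace_poly.
have [->|neq] := eqVneq (Tr q r y) c.
  by rewrite subrr expr0n subn_eq0 leqNgt q_gt1 subr0 mulr1.
suff -> : (Tr q r y - c) ^+ (q - 1) = 1 by rewrite subrr mulr0.
apply: (mulfI (_ : Tr q r y - c != 0)); first by rewrite subr_eq0.
by rewrite -exprS subn1 prednK ?(ltnW q_gt1) // exprB_q Tr_expr_q c_q mulr1.
Qed.

Lemma size_indicator_le b c :
  (size ('X^b * (1 - (T - c%:P) ^+ (q - 1)))%R <= (b + (q - 1) * Q).+1)%N.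
Proof.
have [size_Tc _] := size_trace_polyB_polyC c.
rewrite (leq_trans (size_polyMleq _ _)) // size_polyXn addSn /= -addnS leq_add2l.
rewrite (leq_trans (size_polyD _ _)) // geq_max size_polyN size_poly1 /=.
by rewrite (leq_trans (size_poly_exp_leq _ _)) // size_Tc mulnC.
Qed.

Lemma fiber_sum_eq0 b c : c ^+ q = c -> (b < Q - 1)%N -> fiber_sum b c = 0.
Proof.
move=> c_q b_lt; rewrite fiber_sumE // sum_horner0 //.
by rewrite (leq_ltn_trans (size_indicator_le b c)) // card_FE; nia.
Qed.

Lemma fiber_sum_eq1 c : c ^+ q = c -> fiber_sum (Q - 1) c = 1.
Proof.
have [size_Tc monic_Tc] := size_trace_polyB_polyC c.
have card_Q : (Q - 1 + (q - 1) * Q = #|F|.-1)%N by rewrite card_FE; nia.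
have card_gt0 : (0 < #|F|)%N by rewrite ltnW // card_finField_gt1.
move=> c_q; rewrite fiber_sumE // sum_horner; last first.
  by rewrite (leq_trans (size_indicator_le _ c)) // card_Q prednK.
(* The degree now reaches [#|F|.-1] exactly. The monic power of [T - c%:P] enters the indicator with
   a minus sign, which cancels the sign from [sum_horner]. *)
rewrite mulrBr mulr1 coefB coefXn coefXnM -card_Q.
rewrite (_ : (_ == _)%N = false) ?sub0r; last by apply/negbTE; nia.
rewrite ltnNge leq_addr /= addKn opprK.
have /monicP := monic_exp (q - 1) monic_Tc; rewrite lead_coefE => <-.
by rewrite size_exp size_Tc mulnC.
Qed.

(* Subtracting the value at [0] cancels the leading power of [T], which is what
   lowers the degree enough for the power sums to vanish. *)
Lemma fiber_sum_const b c :
  c ^+ q = c -> (b <= (Q - 1).*2)%N -> fiber_sum b c = fiber_sum b 0.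
Proof.
move=> c_q b_le; apply/eqP; rewrite -subr_eq0 !fiber_sumE ?expr0n ?(gtn_eqF (ltnW q_gt1)) //.
rewrite -sumrB; under eq_bigr do rewrite -hornerN -hornerD -mulrBr.
rewrite sum_horner0 // subr0 opprB addrC addrA subrK subrXX.
rewrite opprB addrCA subrr addr0.
have [size_T _] := size_trace_polyB_polyC 0; rewrite subr0 in size_T.
have [size_Tc _] := size_trace_polyB_polyC c.
rewrite mulrCA mul_polyC (leq_ltn_trans (size_scale_leq _ _)) //.
rewrite (leq_ltn_trans (size_polyMleq _ _)) // size_polyXn addSn /=.
(* The degree is at most [2 * (Q - 1) + (q - 2) * Q = q * Q - 2], just below [#|F|.-1]: this is
   where the bound on [b] comes from. *)
rewrite (@leq_ltn_trans (b + ((q - 2) * Q).+1)) //; last by rewrite card_FE; nia.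
rewrite leq_add2l (leq_trans (size_sum _ _ _)) //; apply/bigmax_leqP => i _.
rewrite (leq_trans (size_polyMleq _ _)) //.
have i_le : (i <= (q - 1).-1)%N by have := ltn_ord i; lia.
have := leq_add (size_poly_exp_leq T ((q - 1).-1 - i))
  (size_poly_exp_leq (T - c%:P) i).
rewrite size_T size_Tc /= addSn addnS -mulnDr subnK // mulnC => le.
rewrite (_ : q - 2 = (q - 1).-1)%N; last by lia.
by rewrite -[X in (X <= _)%N]subn1 leq_subLR add1n.
Qed.

(** * A weight supported on the roots of [X^s.+1 - X] *)

Section Weight.

Variables (s w : nat).
Hypotheses (s_gt0 : (0 < s)%N) (card_sw : #|F|.-1 = (w * s)%N).

(* The quotient of [X^#|F| - X] by [X^s.+1 - X]: at a root of the divisor it is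
   minus the inverse of the derivative of the divisor. *)
Definition root_weight (x : F) : F := \sum_(i < w) x ^+ (i * s).

Let w_gt0 : (0 < w)%N.
Proof.
have : (0 < #|F|.-1)%N by rewrite -subn1 subn_gt0 card_finField_gt1.
by rewrite card_sw muln_gt0 => /andP[].
Qed.

(** Geometric sum: multiplying by [x ^+ s - 1], which is nonzero, gives [x ^+ (w * s) - 1 = 0]. *)
Lemma root_weight_eq0 x : x ^+ s.+1 != x -> root_weight x = 0.
Proof.
move=> x_s; have x0 : x != 0.
  by apply: contra x_s => /eqP ->; rewrite expr0n.
have xs1 : x ^+ s - 1 != 0.
  by apply: contra x_s; rewrite subr_eq0 exprS => /eqP ->; rewrite mulr1.
apply: (mulfI xs1); rewrite mulr0 /root_weight.
under eq_bigr do rewrite mulnC exprM.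
by rewrite -subrX1 -exprM mulnC -card_sw expf_card_pred // subrr.
Qed.

Lemma root_weight0 : root_weight 0 = 1.
Proof.
rewrite /root_weight; move: (w_gt0); case: (w) => // w' _.
rewrite big_ord_recl mul0n expr0 big1 ?addr0 // => i _.
by rewrite expr0n muln_eq0 /= gtn_eqF.
Qed.

(** All [w] summands are 1, and [s * w = #|F|.-1] is -1 in [F]. *)
Lemma root_weight_neq0 x :
  x ^+ s.+1 = x -> x != 0 -> root_weight x = - s%:R^-1.
Proof.
move=> x_s x0; have xs1 : x ^+ s = 1 by apply: (mulfI x0); rewrite -exprS mulr1.
have sw : s%:R * w%:R = -1 :> F.
  rewrite -natrM mulnC -card_sw -subn1 natrB ?natr_card_finField ?sub0r //.
  by rewrite ltnW // card_finField_gt1.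
rewrite /root_weight; under eq_bigr do rewrite mulnC exprM xs1 expr1n.
rewrite sumr_const card_ord.
have s0 : s%:R != 0 :> F.
  by apply: contra_eq_neq sw => ->; rewrite mul0r eq_sym oppr_eq0 oner_eq0.
by apply: (mulfI s0); rewrite sw mulrN divff.
Qed.

(** The exponents [i * s + a] stay below [#|F|.-1], except when [i = w - 1] and [a = s]. *)
Lemma sum_root_weight a :
  (a <= s)%N -> \sum_(x : F) root_weight x * x ^+ a = - (a == s)%:R.
Proof.
move=> a_le; under eq_bigr do rewrite mulr_suml.
rewrite exchange_big /=; under eq_bigr do under eq_bigr do rewrite -exprD.
move: (w_gt0) (card_sw); case: (w) => // w' _ card_sw'.
have lt_card i : (i < w' -> i * s + a < #|F|.-1)%N.
  by rewrite card_sw' => i_lt; nia.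
rewrite big_ord_recr big1 /= => [|i _]; last by rewrite sum_expr_lt ?lt_card.
rewrite add0r; have [->|a_neq] := eqVneq a s.
  by rewrite addnC -mulSn -card_sw' sum_expr_card_pred.
by rewrite oppr0 sum_expr_lt // card_sw' mulSn addnC ltn_add2r ltn_neqAle a_neq.
Qed.

End Weight.

(** * Weighted monomial sums over the curve *)

Section CurveSum.

Variable u : nat.
Hypotheses (u_gt0 : (0 < u)%N) (u_dvd : (u %| (q ^ r - 1) %/ (q - 1))%N).

Local Notation s := ((q - 1) * u)%N.
Local Notation w := (#|F|.-1 %/ s)%N.

Let s_gt0 : (0 < s)%N.
Proof. by rewrite muln_gt0 subn_gt0 q_gt1. Qed.

Let card_sw : #|F|.-1 = (w * s)%N.
Proof.
rewrite divnK // card_F -subn1 -[X in (_ %| X)%N](@divnK (q - 1)); last first.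
  by rewrite !subn1 predn_exp dvdn_mulr.
by rewrite mulnC dvdn_pmul2r // subn_gt0.
Qed.

(** [q] is 0 in [F] because [q ^ r = #|F|] is. The sign turns the weight [- s%:R^-1] into [u%:R^-1],
    the square of [alpha^-1]. *)
Lemma natr_s : s%:R = - u%:R :> F.
Proof.
have q0 : q%:R == 0 :> F.
  have /eqP := natr_card_finField F.
  by rewrite card_F natrX expf_eq0 => /andP[].
by rewrite natrM natrB ?(ltnW q_gt1) // (eqP q0) sub0r mulN1r.
Qed.

Lemma natr_u_neq0 : u%:R != 0 :> F.
Proof.
have : #|F|.-1%:R != 0 :> F.
  rewrite -subn1 natrB ?natr_card_finField ?sub0r ?oppr_eq0 ?oner_eq0 //.
  by rewrite ltnW // card_finField_gt1.
by rewrite card_sw natrM natr_s; apply: contraNneq => ->; rewrite oppr0 mulr0.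
Qed.

(** As a trace value, [x ^+ u] is fixed by [q]-th powers; since [u * q = s + u], the factor [x ^+ u]
    cancels for nonzero [x]. *)
Lemma curve_expr_s (x y : F) : Tr q r y = x ^+ u -> x ^+ s.+1 = x.
Proof.
move=> xy; have [->|x0] := eqVneq x 0; first by rewrite expr0n.
rewrite exprS; apply: (mulIf (expf_neq0 u x0)); rewrite -mulrA -exprD.
have -> : (s + u = u * q)%N by nia.
by rewrite exprM -xy Tr_expr_q.
Qed.

Lemma expr_u_q (x : F) : x ^+ s.+1 = x -> (x ^+ u) ^+ q = x ^+ u.
Proof.
move=> x_s; rewrite -exprM (_ : u * q = s.+1 + u.-1)%N; last first.
  by rewrite addSnnS prednK // mulnBl mul1n subnK ?leq_pmull ?(ltnW q_gt1) // mulnC.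
by rewrite exprD x_s -exprS prednK.
Qed.

Definition curve_weight (x : F) : F := if x != 0 then u%:R^-1 else 1.

Definition curve_sum a b : F :=
  \sum_x \sum_(y | Tr q r y == x ^+ u) curve_weight x * (x ^+ a * y ^+ b).

(** Where [x ^+ s.+1 != x] there is no point of the curve above [x], and [root_weight] vanishes, so
    the sum may run over all of [F]. *)
Lemma curve_sumE a b :
  curve_sum a b = \sum_x root_weight s w x * x ^+ a * fiber_sum b (x ^+ u).
Proof.
apply: eq_bigr => x _; rewrite mulr_sumr; have [x_s|x_s] := eqVneq (x ^+ s.+1) x.
  apply: eq_bigr => y _; rewrite mulrA; congr (_ * _ * _).
  rewrite /curve_weight; have [->|x0] := eqVneq x 0.
    by rewrite root_weight0.
  by rewrite (root_weight_neq0 card_sw) // natr_s invrN opprK.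
rewrite big_pred0 => [|y]; last first.
  by apply: contraNF x_s => /eqP /curve_expr_s ->.
by rewrite big1 // => y _; rewrite root_weight_eq0 ?mul0r.
Qed.

Lemma curve_sum_const a b :
  (forall c, c ^+ q = c -> fiber_sum b c = fiber_sum b 0) ->
  (a <= s)%N -> curve_sum a b = - (a == s)%:R * fiber_sum b 0.
Proof.
move=> b_const a_le; rewrite curve_sumE -(sum_root_weight s_gt0 card_sw) //.
rewrite mulr_suml; apply: eq_bigr => x _.
have [x_s|x_s] := eqVneq (x ^+ s.+1) x; first by rewrite b_const ?expr_u_q.
by rewrite root_weight_eq0 ?mul0r.
Qed.

Lemma curve_sum_eq0 a b :
  (b <= (Q - 1).*2)%N -> (a < s)%N || (b < Q - 1)%N -> curve_sum a b = 0.
Proof.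
move=> b_le; case/orP => [a_lt|b_lt].
  rewrite curve_sum_const ?(ltnW a_lt) // ?(ltn_eqF a_lt) ?oppr0 ?mul0r //.
  by move=> c c_q; apply: fiber_sum_const.
rewrite curve_sumE big1 // => x _.
have [x_s|x_s] := eqVneq (x ^+ s.+1) x.
  by rewrite fiber_sum_eq0 ?mulr0 ?expr_u_q.
by rewrite root_weight_eq0 ?mul0r.
Qed.

Lemma curve_sum_top : curve_sum s (Q - 1) = -1.
Proof.
have q0 : 0 ^+ q = 0 :> F by rewrite expr0n gtn_eqF ?(ltnW q_gt1).
rewrite curve_sum_const // ?eqxx; first by rewrite fiber_sum_eq1 ?mulr1.
by move=> c c_q; rewrite !fiber_sum_eq1.
Qed.

(** * Interpolation at the points, and duality of the codes *)

Section Points.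

Variables (n : nat) (P : 'I_n -> F * F).
Hypotheses (P_inj : injective P) (P_range : range P = norm_trace_points F q r u).

Lemma norm_traceP i : Tr q r (P i).2 = (P i).1 ^+ u.
Proof.
have : range P (P i) by exists i.
by rewrite P_range => ->.
Qed.

Lemma sum_points (G : F -> F -> F) :
  \sum_i G (P i).1 (P i).2 = \sum_x \sum_(y | Tr q r y == x ^+ u) G x y.
Proof.
rewrite pair_big_dep /=.
rewrite (reindex_omap P (fun p => [pick i | P i == p])) => [|p /eqP p_curve].
  apply: eq_bigl => i; rewrite norm_traceP eqxx /=.
  case: pickP => [j /eqP/P_inj ->|/(_ i)]; by rewrite eqxx.
case: pickP => [i /eqP <- //|no_i].
have : range P p by rewrite P_range /norm_trace_points /= p_curve.
by case=> i _ Pi; have := no_i i; rewrite Pi eqxx.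
Qed.

(** The indicator of a point is a polynomial in x of degree at most [s] times one in y of degree
    below [Q]; every word is a combination of such indicators. *)
Lemma curve_interpolation (v : 'I_n -> F) :
  exists c : nat -> nat -> F, forall j,
    v j = \sum_(a < s.+1) \sum_(b < Q) c a b * ((P j).1 ^+ a * (P j).2 ^+ b).
Proof.
have indicator i : exists c : nat -> nat -> F, forall j, (j == i)%:R =
    \sum_(a < s.+1) \sum_(b < Q) c a b * ((P j).1 ^+ a * (P j).2 ^+ b).
  have size_f : size ('X^(s.+1) - 'X : {poly F})%R = s.+2.
    by rewrite size_polyDl size_polyXn // size_polyN size_polyX.
  have root_f j : root ('X^(s.+1) - 'X) (P j).1.
    by rewrite rootE !hornerE subr_eq0 (curve_expr_s (norm_traceP j)).
  have [|Lx] := exists_root_indicator _ (root_f i).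
    by rewrite -size_poly_gt0 size_f.
  rewrite size_f ltnS => size_Lx LxE.
  have [size_g monic_g] := size_trace_polyB_polyC ((P i).1 ^+ u).
  set g := T - _ in size_g monic_g.
  have root_g j : root g (P j).2 = ((P j).1 ^+ u == (P i).1 ^+ u).
    by rewrite rootE !hornerE horner_trace_poly norm_traceP subr_eq0.
  have [| |Ly] := @exists_root_indicator _ g (P i).2.
  - exact: monic_neq0.
  - by rewrite root_g.
  rewrite size_g ltnS => size_Ly LyE.
  (* [Ly] is an indicator only on the roots of [g]. This suffices, as [Lx] already vanishes at the
     points whose x-coordinate differs from that of [P i]. *)
  exists (fun a b => Lx`_a * Ly`_b) => j.
  transitivity (Lx.[(P j).1] * Ly.[(P j).2]).
    rewrite LxE //; have [eq1|neq1] := eqVneq (P j).1 (P i).1; last first.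
      by rewrite mul0r; case: eqP => // ji; rewrite ji eqxx in neq1.
    rewrite mul1r LyE ?root_g ?eq1 //; congr (nat_of_bool _)%:R.
    apply/eqP/eqP => [-> //|eq2]; apply: P_inj.
    by rewrite (surjective_pairing (P j)) eq1 eq2 -surjective_pairing.
  rewrite (horner_coef_wide _ size_Lx) (horner_coef_wide _ size_Ly) mulr_suml.
  apply: eq_bigr => a _; rewrite mulr_sumr; apply: eq_bigr => b _.
  by rewrite mulrACA.
have [c cE] := fin_all_exists indicator.
exists (fun a b => \sum_i v i * c i a b) => j.
transitivity (\sum_i v i * (j == i)%:R).
  rewrite (bigD1 j) //= eqxx mulr1 big1 ?addr0 // => i /negbTE.
  by rewrite eq_sym => ->; rewrite mulr0.
under eq_bigr do rewrite cE mulr_sumr.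
rewrite exchange_big; apply: eq_bigr => a _ /=.
under eq_bigr do rewrite mulr_sumr.
rewrite exchange_big; apply: eq_bigr => b _ /=.
by rewrite mulr_suml; apply: eq_bigr => i _; rewrite mulrA.
Qed.

Variables (M : set 'X_{1..2}) (alpha : F) (lambda : 'rV[F]_n).
Hypotheses (M_sub : M `<=` footprint (s + 1) Q) (M_closed : div_closed M).
Hypotheses (alpha_sqr : alpha ^+ 2 = u%:R).
Hypothesis lambda_def : forall i : 'I_n,
  lambda 0 i = if (P i).1 != 0 then alpha^-1 else 1.

Lemma lambda_neq0 i : lambda 0 i != 0.
Proof.
rewrite lambda_def; case: ifP; rewrite ?oner_neq0 // invr_eq0 => _.
by have := natr_u_neq0; rewrite -alpha_sqr expf_eq0.
Qed.

Lemma sum_lambda_points a b :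
  \sum_j lambda 0 j ^+ 2 * ((P j).1 ^+ a * (P j).2 ^+ b) = curve_sum a b.
Proof.
rewrite /curve_sum -(sum_points (fun x y => curve_weight x * (x ^+ a * y ^+ b))).
apply: eq_bigr => j _; congr (_ * _); rewrite lambda_def /curve_weight.
by case: ifP => _; rewrite ?expr1n // exprVn alpha_sqr.
Qed.

Lemma star_ev_code_ortho : M `<=` compl_mon q r u M ->
  star lambda (ev_code P M) `<=` dual_code (star lambda (ev_code P M)).
Proof.
move=> M_compl _ [_ [f Mf <-] <-] _ [_ [g Mg <-] <-].
under eq_bigr do rewrite [X in X * _]mxE [X in _ * X]mxE mulrA.
apply: (sum_ev_eq0 (v := fun j => lambda 0 j * ev P f 0 j * lambda 0 j)) Mg.
move=> m Mm; under eq_bigr do rewrite -mulrA mulrAC.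
apply: (sum_ev_eq0 (v := fun j => lambda 0 j * (lambda 0 j * ev P 'X_[m] 0 j))) Mf.
move=> m' Mm'.
transitivity (curve_sum (m ord0 + m' ord0) (m ord_max + m' ord_max)).
  rewrite -sum_lambda_points; apply: eq_bigr => j _; rewrite !evX !exprD.
  ring.
have [_ /leq_Q m1_le] := (footprintP _ _ _).1 (M_sub Mm).
have [_ /leq_Q m1'_le] := (footprintP _ _ _).1 (M_sub Mm').
apply: curve_sum_eq0; first by rewrite -addnn leq_add.
(* [m'] is complementary to some [d] outside [M]. By closedness [d] does not divide [m], so in some
   variable [m + m'] stays below the top exponent. *)
have [d [d_foot notMd] m'E] := M_compl _ Mm'.
have [] := (footprintP _ _ _).1 d_foot; rewrite addn1 ltnS => d0_le /leq_Q d1_le.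
have : ~~ (d <= m)%MM by apply/negP => /(M_closed Mm).
rewrite xymon_leP -m'E !mnmBE !xymon0 !xymon1 negb_and -!ltnNge.
by case/orP => lt; apply/orP; [left|right]; apply: ltn_add_subn.
Qed.

Lemma dual_sub_star_ev_code : M = compl_mon q r u M ->
  dual_code (star lambda (ev_code P M)) `<=` star lambda (ev_code P M).
Proof.
move=> M_compl v v_dual.
(* Dividing by [lambda] here makes the pairing of [v] with a codeword carry the weight
   [lambda ^+ 2], as in [curve_sum]. *)
have [c cE] := curve_interpolation (fun j => v 0 j / lambda 0 j).
have sum_c a b : M (xymon a b) ->
    \sum_(a' < s.+1) \sum_(b' < Q) c a' b' * curve_sum (a' + a) (b' + b) = 0.
  move=> Mab; pose z := \row_j (lambda 0 j * ev P 'X_[xymon a b] 0 j).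
  have /v_dual v_z : star lambda (ev_code P M) z.
    exists (ev P 'X_[xymon a b]) => //.
    by exists 'X_[xymon a b] => //; apply: mon_spanX.
  rewrite -[RHS]v_z; transitivity (\sum_j lambda 0 j ^+ 2 * (v 0 j / lambda 0 j) *
      ((P j).1 ^+ a * (P j).2 ^+ b)); last first.
    apply: eq_bigr => j _; rewrite mxE evX xymon0 xymon1.
    by field; exact: lambda_neq0.
  under [RHS]eq_bigr do rewrite cE mulr_sumr mulr_suml.
  rewrite [RHS]exchange_big; apply: eq_bigr => a' _ /=.
  under [RHS]eq_bigr do rewrite mulr_sumr mulr_suml.
  rewrite [RHS]exchange_big; apply: eq_bigr => b' _ /=.
  rewrite -sum_lambda_points mulr_sumr; apply: eq_bigr => j _; rewrite !exprD.
  ring.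
(* Descending induction on [a + b], with [k] as fuel; since [a + b < s + Q], the truncated
   difference strictly decreases. *)
have c_eq0 k a b : (a <= s)%N -> (b < Q)%N -> (s + Q - (a + b) < k)%N ->
    ~ M (xymon a b) -> c a b = 0.
  elim: k a b => // k IHk a b a_le b_lt k_lt notM.
  have : M (xymon (s - a) (Q - 1 - b)).
    rewrite M_compl; exists (xymon a b).
      by split=> //; apply/footprintP; rewrite xymon0 xymon1 addn1.
    by rewrite -[LHS]xymonK !mnmBE !xymon0 !xymon1.
  move/sum_c; have a_lt : (a < s.+1)%N by [].
  rewrite (bigD1 (Ordinal a_lt)) //= (bigD1 (Ordinal b_lt)) //=.
  have b_le := leq_Q b_lt.
  rewrite !subnKC // curve_sum_top mulrN1.
  (* If [a' < a] or [b' < b], the curve sum vanishes. Otherwise [xymon a b] properly divides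
     [xymon a' b'], which is then outside [M] and falls under the induction hypothesis. *)
  have term_eq0 a' b' : (a' <= s)%N -> (b' < Q)%N -> (a', b') != (a, b) ->
      c a' b' * curve_sum (a' + (s - a)) (b' + (Q - 1 - b)) = 0.
    move=> a'_le b'_lt; rewrite xpair_eqE negb_and => neq.
    have [/orP lt|] := boolP ((a' < a) || (b' < b))%N.
      rewrite curve_sum_eq0 ?mulr0 //.
        by rewrite -addnn leq_add ?leq_subr // leq_Q.
      by apply/orP; case: lt => lt; [left|right]; apply: ltn_add_subn.
    rewrite negb_or -!leqNgt => /andP[a_le' b_le'].
    rewrite (IHk a' b') ?mul0r //.
      by clear -neq a_le' b_le' k_lt a'_le b'_lt; lia.
    move=> Mab'; apply/notM/(M_closed Mab').
    by rewrite xymon_leP !xymon0 !xymon1 a_le' b_le'.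
  rewrite addrC big1 => [|a' /eqP/val_eqP /= neq]; last first.
    rewrite big1 // => b' _.
    by apply: term_eq0; rewrite ?xpair_eqE ?(negbTE neq) // -ltnS.
  rewrite add0r big1 => [|b' /eqP/val_eqP /= neq]; last first.
    have := term_eq0 a b' a_le (ltn_ord b'); rewrite subnKC // => -> //.
    by rewrite xpair_eqE (negbTE neq) andbF.
  by rewrite addr0 => /eqP; rewrite oppr_eq0 => /eqP.
pose f : {mpoly F[2]} :=
  \sum_(a < s.+1) \sum_(b < Q) c a b *: 'X_[xymon a b].
exists (ev P f).
  exists f => //; rewrite /f.
  have spanD g h : mon_span F M g -> mon_span F M h -> mon_span F M (g + h).
    by rewrite -{2}[g]scale1r; apply: mon_span_linear.
  apply: big_ind => [|//|a _]; first exact: mon_span0.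
  apply: big_ind => [|//|b _]; first exact: mon_span0.
  have [Mab|notM] := pselect (M (xymon a b)).
    by rewrite -[_ *: _]addr0; apply: mon_span_linear (mon_spanX _ Mab) (mon_span0 _ _).
  rewrite (c_eq0 (s + Q).+1 a b) ?scale0r //; first exact: mon_span0.
  - by rewrite -ltnS.
  - by rewrite ltnS leq_subr.
apply/rowP => j; rewrite mxE.
have -> : v 0 j = lambda 0 j * (v 0 j / lambda 0 j).
  by rewrite mulrC divfK ?lambda_neq0.
rewrite cE; congr (_ * _); rewrite mxE raddf_sum; apply: eq_bigr => a _ /=.
rewrite raddf_sum; apply: eq_bigr => b _ /=.
by have := evX P (xymon a b) j; rewrite mxE mevalZ xymon0 xymon1 => ->.
Qed.

End Points.

End CurveSum.

End Trace.

Theorem corollary5p4 (p k q r u : nat) (F : finFieldType)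
  (p_prime : prime p) (k_gt0 : (0 < k)%N) (q_def : q = (p ^ k)%N)
  (r_ge2 : (2 <= r)%N)
  (card_F : #|F| = (q ^ r)%N)
  (u_gt0 : (0 < u)%N) (u_dvd : (u %| (q ^ r - 1) %/ (q - 1))%N)
  (n : nat) (P : 'I_n -> F * F)
  (P_inj : injective P) (P_range : range P = norm_trace_points F q r u)
  (M : set 'X_{1..2})
  (M_sub : M `<=` footprint ((q - 1) * u + 1) (q ^ (r - 1)))
  (M_closed : div_closed M)
  (alpha : F) (alpha_sqr : alpha ^+ 2 = u%:R)
  (lambda : 'rV[F]_n)
  (lambda_def : forall i : 'I_n,
     lambda 0 i = if (P i).1 != 0 then alpha^-1 else 1) :
  (M `<=` compl_mon q r u M -> self_orthogonal (star lambda (ev_code P M))) /\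
  (M = compl_mon q r u M -> self_dual (star lambda (ev_code P M))).
Proof.
(* [q] is a power of the characteristic, which makes [q]-th powers additive. *)
have p_char : p \in [pchar F].
  by apply: (@card_finPcharP F p (k * r)) => //; rewrite card_F q_def expnM.
have q_char : [pchar F].-nat q by rewrite q_def pnatX pnatE ?p_char.
have q_gt1 : (1 < q)%N.
  by rewrite q_def -[1%N](expn0 p) ltn_exp2l ?prime_gt1.
have r_gt0 : (0 < r)%N by apply: ltnW.
have ortho := star_ev_code_ortho q_gt1 r_gt0 card_F q_char u_gt0 u_dvd
  P_inj P_range M_sub M_closed alpha_sqr lambda_def.
have dual_sub := dual_sub_star_ev_code q_gt1 r_gt0 card_F q_char u_gt0 u_dvd
  P_inj P_range M_closed alpha_sqr lambda_def.
split=> M_compl; split; [exact: linear_star_ev_code|exact: ortho|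
                         exact: linear_star_ev_code|].
by apply/seteqP; split; [apply: ortho; rewrite -M_compl|exact: dual_sub].
Qed.
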